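(* For $i=1,2$ consider forward complete systems $\Sigma_i:\ \frac{d}{dt}x_i(t)=f_i(x_i(t),w_i(t))$ with $x_i(0)\in\mathbb{R}^{n_i}$, $w_i\in\mathcal{W}^{m_i}$, where $f_i:\mathbb{R}^{n_i}\times\mathbb{R}^{m_i}\to\mathbb{R}^{n_i}$ is locally Lipschitz in its first argument, locally uniformly in its second argument, and $m_1=n_2$, $m_2=n_1$. Suppose both systems are iISS with functions $\alpha_i,\beta_i,\gamma_i,\sigma_i\in\mathcal{K}_\infty$: $$\int_0^t\alpha_i(|x_i(\tau)|)d\tau\le\max\left\{\beta_i(|x_i(0)|),\ \gamma_i\left(\int_0^t\sigma_i(|w_i(\tau)|)d\tau\right)\right\}$$ for all $x_i(0)\in\mathbb{R}^{n_i}$, $w_i\in\mathcal{W}^{m_i}$, $t\ge0$. Suppose the systems are connected in feedback with $w_1=x_2$ and $w_2=x_1$, and this interconnection is forward complete. Let $T_i:\mathbb{R}^{n_i}\to\mathbb{R}^{n_i}$ and $S_i:\mathbb{R}^{m_i}\to\mathbb{R}^{m_i}$, $i=1,2$, be changes of coordinates in which $\Sigma_1$ and $\Sigma_2$ satisfy nonlinear $\mathcal{L}_2$-gain bounds, i.e. for some $\hat\beta_i,\hat\gamma_i\in\mathcal{K}_\infty$, $$\|T_i(x_i)\|_{\mathcal{L}_2[0,t]}^2\le\max\left\{\hat\beta_i(|T_i(x_i(0))|),\ \hat\gamma_i\left(\|S_i(w_i)\|_{\mathcal{L}_2[0,t]}^2\right)\right\}$$ for all $x_i(0)\in\mathbb{R}^{n_i}$,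 $w_i\in\mathcal{W}^{m_i}$, $t\ge0$ (for iISS systems such changes of coordinates always exist). If there exist $c_1,c_2>0$ such that, for $i,j=1,2$, $i\ne j$, $$|S_j(\zeta)|\le\sqrt{c_i}\,|T_i(\zeta)|\quad\text{for all }\zeta\in\mathbb{R}^{n_i},$$ and if, for $i,j=1,2$, $i\neq j$, the small-gain conditions hold that the function $$s\mapsto s-\hat\gamma_i\left(c_j\hat\gamma_j(c_i s)\right)$$ is of class $\mathcal{K}_\infty$, then the feedback interconnection is $\alpha$-integrable; that is, there exist $\alpha,\beta\in\mathcal{K}_\infty$ such that, with $x=[x_1^T\ x_2^T]^T$, $\int_0^t\alpha(|x(\tau)|)d\tau\le\beta(|x(0)|)$ for all $x(0)\in\mathbb{R}^{n_1+n_2}$ and $t\ge0$.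
   Context: $\mathcal{W}^m$ is the set of measurable, locally essentially bounded functions $w:\mathbb{R}_{\ge0}\to\mathbb{R}^m$. Forward complete means that for every initial condition and every input in the input class (if any) the solution exists for all $t\ge 0$. $\mathcal{K}_\infty$ is the class of continuous, strictly increasing, unbounded functions $\alpha:\mathbb{R}_{\ge0}\to\mathbb{R}_{\ge0}$ with $\alpha(0)=0$. $|\cdot|$ is the Euclidean norm, and $\|y\|_{\mathcal{L}_2[0,t]}^2:=\int_0^t|y(\tau)|^2d\tau$; $T_i(x_i)$ and $S_i(w_i)$ denote the functions $\tau\mapsto T_i(x_i(\tau))$ and $\tau\mapsto S_i(w_i(\tau))$. A change of coordinates is a homeomorphism $T:\mathbb{R}^p\to\mathbb{R}^p$ with $T(0)=0$ (differentiability is not required). iISS stands for integral input-to-state stable. *)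

(* Defs.v *)
From mathcomp Require Import all_boot all_order all_algebra.
From mathcomp Require Import all_classical all_reals all_analysis.

Set Implicit Arguments.
Unset Strict Implicit.
Unset Printing Implicit Defensive.

Import Order.TTheory GRing.Theory Num.Theory.
Import numFieldNormedType.Exports.

Local Open Scope classical_set_scope.
Local Open Scope ring_scope.

Section Defs.
Context {R : realType}.

Local Notation mu := (@lebesgue_measure R).

(* Euclidean norm; the canonical norm `|x| on matrices is the max norm, which
   induces the same topology. *)
Definition enorm n (x : 'cV[R]_n) : R := Num.sqrt (\sum_i x i 0 ^+ 2).

(* Functions on the half-line [0, +oo[, in particular comparison functions,
   inputs and trajectories, are represented by functions on R whose values at
   negative arguments are irrelevant. *)
Definition Kinfty (a : R -> R) : Prop :=
  [/\ a 0 = 0,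
      {within `[0, +oo[, continuous a},
      {in `[0, +oo[ &, {homo a : r s / r < s}} &
      forall M, exists2 s : R, 0 <= s & M < a s].

(* Borel measurability loses nothing: a Lebesgue measurable input agrees a.e. with
   a Borel one, with the same Caratheodory solutions and the same integrals. *)
Definition inputW m (w : R -> 'cV[R]_m) : Prop :=
  (forall i, measurable_fun (`[0, +oo[ : set R) (fun t => w t i 0)) /\
  (forall t : R, 0 <= t ->
     exists M : R, {ae mu, forall s, 0 <= s <= t -> enorm (w s) <= M}).

Definition loc_lipschitz n m (f : 'cV[R]_n -> 'cV[R]_m -> 'cV[R]_n) : Prop :=
  forall (x0 : 'cV[R]_n) (w0 : 'cV[R]_m), exists U V (L : R),
    [/\ nbhs x0 U, nbhs w0 V &
        forall x y w, U x -> U y -> V w ->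
          enorm (f x w - f y w) <= L * enorm (x - y)].

Definition abs_continuous n (a b : R) (x : R -> 'cV[R]_n) : Prop :=
  forall e : R, 0 < e -> exists2 d : R, 0 < d &
    forall (p : nat) (u v : 'I_p -> R),
      (forall i, [/\ a <= u i, u i <= v i & v i <= b]) ->
      trivIset [set: 'I_p] (fun i => `]u i, v i[%classic) ->
      \sum_i (v i - u i) < d ->
      \sum_i enorm (x (v i) - x (u i)) < e.

(* Caratheodory solutions on [0, +oo[, as the inputs are merely measurable. *)
Definition is_solution n m (f : 'cV[R]_n -> 'cV[R]_m -> 'cV[R]_n)
    (w : R -> 'cV[R]_m) (x : R -> 'cV[R]_n) : Prop :=
  (forall t : R, 0 <= t -> abs_continuous 0 t x) /\
  {ae mu, forall t : R, 0 < t -> is_derive t 1 x (f (x t) (w t))}.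

Definition forward_complete n m (f : 'cV[R]_n -> 'cV[R]_m -> 'cV[R]_n) : Prop :=
  forall x0 w, inputW w -> exists2 x, is_solution f w x & x 0 = x0.

(* The right-hand integrals below are finite for inputs in the class inputW, and
   the left-hand ones because trajectories are continuous; so Rintegral, which
   sends infinite integrals to 0, is the actual integral. *)
Definition iISS n m (f : 'cV[R]_n -> 'cV[R]_m -> 'cV[R]_n)
    (alpha beta gamma sigma : R -> R) : Prop :=
  [/\ Kinfty alpha, Kinfty beta, Kinfty gamma, Kinfty sigma &
      forall w x, inputW w -> is_solution f w x -> forall t : R, 0 <= t ->
        \int[mu]_(s in `[0, t]) alpha (enorm (x s)) <=
        Num.max (beta (enorm (x 0)))
                (gamma (\int[mu]_(s in `[0, t]) sigma (enorm (w s))))].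

Definition change_of_coordinates p (T : 'cV[R]_p -> 'cV[R]_p) : Prop :=
  [/\ T 0 = 0, continuous T &
      exists T', [/\ cancel T T', cancel T' T & continuous T']].

Definition sqnormL2 n (t : R) (y : R -> 'cV[R]_n) : R :=
  \int[mu]_(s in `[0, t]) enorm (y s) ^+ 2.

Definition L2_gain n m (f : 'cV[R]_n -> 'cV[R]_m -> 'cV[R]_n)
    (T : 'cV[R]_n -> 'cV[R]_n) (S : 'cV[R]_m -> 'cV[R]_m)
    (betah gammah : R -> R) : Prop :=
  [/\ Kinfty betah, Kinfty gammah &
      forall w x, inputW w -> is_solution f w x -> forall t : R, 0 <= t ->
        sqnormL2 t (T \o x) <=
        Num.max (betah (enorm (T (x 0)))) (gammah (sqnormL2 t (S \o w)))].

Definition is_feedback_solution n1 n2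
    (f1 : 'cV[R]_n1 -> 'cV[R]_n2 -> 'cV[R]_n1)
    (f2 : 'cV[R]_n2 -> 'cV[R]_n1 -> 'cV[R]_n2)
    (x1 : R -> 'cV[R]_n1) (x2 : R -> 'cV[R]_n2) : Prop :=
  is_solution f1 x2 x1 /\ is_solution f2 x1 x2.

Definition feedback_forward_complete n1 n2
    (f1 : 'cV[R]_n1 -> 'cV[R]_n2 -> 'cV[R]_n1)
    (f2 : 'cV[R]_n2 -> 'cV[R]_n1 -> 'cV[R]_n2) : Prop :=
  forall x10 x20, exists x1 x2,
    [/\ is_feedback_solution f1 f2 x1 x2, x1 0 = x10 & x2 0 = x20].

Definition feedback_alpha_integrable n1 n2
    (f1 : 'cV[R]_n1 -> 'cV[R]_n2 -> 'cV[R]_n1)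
    (f2 : 'cV[R]_n2 -> 'cV[R]_n1 -> 'cV[R]_n2) : Prop :=
  exists alpha beta, [/\ Kinfty alpha, Kinfty beta &
    forall x1 x2, is_feedback_solution f1 f2 x1 x2 -> forall t : R, 0 <= t ->
      \int[mu]_(s in `[0, t]) alpha (enorm (col_mx (x1 s) (x2 s))) <=
      beta (enorm (col_mx (x1 0) (x2 0)))].

End Defs.

(* Main.v *)
(** Along a feedback solution let [a_i(t)] be the squared L2 norm of [T_i(x_i)]
    on [[0, t]]. The bound of [S_j] by [T_i] turns the two gain inequalities into
    [a_1 <= max b_1 (g_1 (c_2 a_2))] and [a_2 <= max b_2 (g_2 (c_1 a_1))], where
    [b_i] depends on the initial states only. Substituting the second into the
    first gives the alternative [a_1 <= g_1 (c_2 (g_2 (c_1 a_1)))], which the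
    small-gain condition allows only for [a_1 = 0]; hence
    [a_1 <= max b_1 (g_1 (c_2 b_2))], and symmetrically for [a_2]. To return to
    [x], note that [T_i] and its inverse are continuous and vanish at [0], so their
    norms are dominated by class K-infinity functions of the norm of the argument:
    with [phi] such a function for both inverses,
    [phi^-1(|x|)^2 <= |T_1(x_1)|^2 + |T_2(x_2)|^2]. *)

Require Import Defs.
From mathcomp Require Import all_boot all_order all_algebra.
From mathcomp Require Import all_classical all_reals all_analysis.
From mathcomp Require Import measurable_realfun.
From mathcomp Require Import lra.

Import Order.TTheory GRing.Theory Num.Theory.
Import numFieldNormedType.Exports.

Local Open Scope classical_set_scope.
Local Open Scope ring_scope.

Set Implicit Arguments.
Unset Strict Implicit.
Unset Printing Implicit Defensive.

(** * Elementary estimates for the Euclidean norm *)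

Section EuclideanNorm.
Context {R : realType}.

Lemma enorm_ge0 n (x : 'cV[R]_n) : 0 <= enorm x.
Proof. exact: sqrtr_ge0. Qed.

Lemma sqr_enorm n (x : 'cV[R]_n) : enorm x ^+ 2 = \sum_i x i 0 ^+ 2.
Proof. by rewrite sqr_sqrtr// sumr_ge0// => i _; exact: sqr_ge0. Qed.

Lemma enorm0 n : enorm (0 : 'cV[R]_n) = 0.
Proof. by rewrite /enorm big1 ?sqrtr0// => i _; rewrite mxE expr0n. Qed.

Lemma enormN n (x : 'cV[R]_n) : enorm (- x) = enorm x.
Proof. by congr Num.sqrt; apply: eq_bigr => i _; rewrite mxE sqrrN. Qed.

Lemma coord_le_enorm n (x : 'cV[R]_n) i : `|x i 0| <= enorm x.
Proof.
rewrite -sqrtr_sqr ler_sqrt ?sumr_ge0// => [|j _]; last exact: sqr_ge0.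
by rewrite (bigD1 i)//= lerDl sumr_ge0// => j _; exact: sqr_ge0.
Qed.

(** Convergence of vectors is expressed in the max norm; this carries Euclidean estimates over to
    the topology. *)
Lemma norm_le_enorm n (x : 'cV[R]_n) : `|x| <= enorm x.
Proof.
rewrite /Num.norm/= mx_normrE; apply: bigmax_le; first exact: enorm_ge0.
by move=> [i j] _ /=; rewrite (ord1 j); exact: coord_le_enorm.
Qed.

Lemma sqr_enorm_col_mx n1 n2 (x1 : 'cV[R]_n1) (x2 : 'cV[R]_n2) :
  enorm (col_mx x1 x2) ^+ 2 = enorm x1 ^+ 2 + enorm x2 ^+ 2.
Proof.
rewrite !sqr_enorm big_split_ord/=; congr (_ + _).
- by apply: eq_bigr => i _; rewrite col_mxEu.
- by apply: eq_bigr => i _; rewrite col_mxEd.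
Qed.

Lemma enorm_col_mx_ge n1 n2 (x1 : 'cV[R]_n1) (x2 : 'cV[R]_n2) :
  enorm x1 <= enorm (col_mx x1 x2) /\ enorm x2 <= enorm (col_mx x1 x2).
Proof.
have := sqr_enorm_col_mx x1 x2.
move: (enorm_ge0 x1) (enorm_ge0 x2) (enorm_ge0 (col_mx x1 x2)) => *.
by split; nra.
Qed.

Lemma enorm_col_mx_le n1 n2 (x1 : 'cV[R]_n1) (x2 : 'cV[R]_n2) :
  enorm (col_mx x1 x2) <= enorm x1 + enorm x2.
Proof.
have := sqr_enorm_col_mx x1 x2.
move: (enorm_ge0 x1) (enorm_ge0 x2) (enorm_ge0 (col_mx x1 x2)) => *.
by nra.
Qed.

Lemma enorm_continuous n : continuous (@enorm R n).
Proof.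
have csq i : continuous (fun y : 'cV[R]_n => y i 0 ^+ 2).
  move=> y; apply: (continuous_comp (f := fun y : 'cV[R]_n => y i 0)
    (g := fun r : R => r ^+ 2)).
    exact: coord_continuous.
  exact: exprn_continuous.
move=> x; rewrite /enorm.
apply: (continuous_comp (f := fun y : 'cV[R]_n => \sum_i y i 0 ^+ 2));
  last exact: sqrt_continuous.
have -> : (fun y : 'cV[R]_n => \sum_i y i 0 ^+ 2) =
          \sum_i (fun y : 'cV[R]_n => y i 0 ^+ 2).
  by apply/funext => y; rewrite fct_sumE.
elim/big_rec : _ => [|i f _ cf].
  by move: x; exact: (@cst_continuous _ R 0).
by apply: continuousD cf; exact: csq.
Qed.

End EuclideanNorm.

(** * Calculus of class K-infinity functions: closure properties and inverses *)

Section ComparisonFunctions.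
Context {R : realType}.
Implicit Types (a b : R -> R).

Lemma maxr0_continuous : continuous (fun r : R => Num.max 0 r).
Proof. by move=> r; apply: continuous_max; [exact: cvg_cst|exact: cvg_id]. Qed.

(** Trades the subspace topology of the half-line for ordinary continuity of the extension that is
    constant on negative arguments, to which the rules for sums and composites apply directly. *)
Lemma within_ge0_continuousP a :
  {within `[0, +oo[, continuous a} <-> continuous (fun r : R => a (Num.max 0 r)).
Proof.
split=> [/subspace_continuousP ca r|ca].
- apply: (@cvg_comp R R R (fun r : R => Num.max 0 r) a _
            (within `[0, +oo[ (nbhs (Num.max 0 r)))); last first.
    by apply: ca; rewrite /= in_itv/= andbT le_max lexx.
  move=> U; rewrite /within/= => nU.
  have nr : \forall s \near r, `[0, +oo[%classic (Num.max 0 s) -> U (Num.max 0 s).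
    exact: maxr0_continuous nU.
  suff : \forall s \near r, U (Num.max 0 s) by [].
  near=> s; have : `[0, +oo[%classic (Num.max 0 s).
    by rewrite /= in_itv/= andbT le_max lexx.
  by near: s.
- have ca0 := continuous_subspaceT (A := `[0, +oo[ : set R) ca.
  apply: (subspace_eq_continuous _ ca0) => r /set_mem/=.
  by rewrite /from_subspace in_itv/= andbT => r0; rewrite max_r.
Unshelve. all: by end_near.
Qed.

Lemma Kinfty0 a : Kinfty a -> a 0 = 0. Proof. by case. Qed.

Lemma Kinfty_lt a r s : Kinfty a -> 0 <= r -> r < s -> a r < a s.
Proof.
case=> _ _ a_lt _ r0 rs; apply: a_lt => //; rewrite in_itv/= andbT //.
exact: le_trans r0 (ltW rs).
Qed.

Lemma Kinfty_le a r s : Kinfty a -> 0 <= r -> r <= s -> a r <= a s.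
Proof.
by move=> Ka r0; rewrite le_eqVlt => /predU1P[->//|/(Kinfty_lt Ka r0)/ltW].
Qed.

Lemma Kinfty_ge0 a r : Kinfty a -> 0 <= r -> 0 <= a r.
Proof. by move=> Ka r0; rewrite -(Kinfty0 Ka); exact: Kinfty_le. Qed.

Lemma Kinfty_continuous a :
  Kinfty a -> continuous (fun r : R => a (Num.max 0 r)).
Proof. by case=> _ /within_ge0_continuousP. Qed.

Lemma Kinfty_intro a :
  a 0 = 0 -> continuous (fun r : R => a (Num.max 0 r)) ->
  (forall r s, 0 <= r -> r < s -> a r < a s) ->
  (forall M, exists2 s, 0 <= s & M < a s) -> Kinfty a.
Proof.
move=> a0 ca a_lt a_unb; split=> //; first exact/within_ge0_continuousP.
by move=> r s; rewrite !in_itv/= !andbT => r0 _; exact: a_lt.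
Qed.

Lemma Kinfty_comp a b : Kinfty a -> Kinfty b -> Kinfty (a \o b).
Proof.
move=> Ka Kb; apply: Kinfty_intro => /=.
- by rewrite (Kinfty0 Kb) (Kinfty0 Ka).
(* The truncation inserted before [a] changes nothing, since [b] is nonnegative on the half-line. *)
- have -> : (fun r => a (b (Num.max 0 r))) =
      (fun r : R => a (Num.max 0 r)) \o (fun r : R => b (Num.max 0 r)).
    apply/funext => r /=; congr a; rewrite [RHS]max_r//.
    by apply: Kinfty_ge0 => //; rewrite le_max lexx.
  by move=> r; apply: continuous_comp; exact: Kinfty_continuous.
- move=> r s r0 rs; apply: Kinfty_lt => //; first exact: Kinfty_ge0.
  exact: Kinfty_lt.
- move=> M; have [s s0 Ms] : exists2 s, 0 <= s & M < a s by case: Ka.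
  have [r r0 sr] : exists2 r, 0 <= r & s < b r by case: Kb.
  by exists r => //; apply: lt_trans Ms _; exact: Kinfty_lt.
Qed.

Lemma Kinfty_add a b : Kinfty a -> Kinfty b -> Kinfty (fun r => a r + b r).
Proof.
move=> Ka Kb; apply: Kinfty_intro => /=.
- by rewrite (Kinfty0 Kb) (Kinfty0 Ka) addr0.
- by move=> r; apply: cvgD; exact: Kinfty_continuous.
- by move=> r s r0 rs; apply: ltrD; exact: Kinfty_lt.
- move=> M; have [s s0 Ms] : exists2 s, 0 <= s & M < a s by case: Ka.
  by exists s => //; apply: lt_le_trans Ms _; rewrite lerDl Kinfty_ge0.
Qed.

Lemma Kinfty_scale (c : R) : 0 < c -> Kinfty (fun r => c * r).
Proof.
move=> c0; apply: Kinfty_intro => /=.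
- by rewrite mulr0.
- by move=> r; apply: cvgM; [exact: cvg_cst|exact: maxr0_continuous].
- by move=> r s _; rewrite ltr_pM2l.
(* The absolute value keeps the witness nonnegative when [M] is negative. *)
- move=> M; exists ((`|M| + 1) / c); first by rewrite divr_ge0 ?ltW// ltr_wpDl.
  by rewrite mulrC divfK ?gt_eqF//; apply: le_lt_trans (ler_norm M) _; rewrite ltrDl.
Qed.

Lemma Kinfty_sqr : Kinfty (fun r : R => r ^+ 2).
Proof.
apply: Kinfty_intro => /=.
- by rewrite expr0n.
- move=> r; apply: (continuous_comp (f := fun r : R => Num.max 0 r)
    (g := fun r : R => r ^+ 2)).
    exact: maxr0_continuous.
  exact: exprn_continuous.
- by move=> r s r0 rs; rewrite ltrXn2r// ltW.
- move=> M; exists (`|M| + 1); first by rewrite ltW// ltr_wpDl.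
  by have := ler_norm M; have := normr_ge0 M; nra.
Qed.

Lemma Kinfty_lt_reflect a r s :
  Kinfty a -> 0 <= s -> a r < a s -> 0 <= r -> r < s.
Proof.
move=> Ka s0 ars r0; rewrite ltNge; apply: contraL ars => /(Kinfty_le Ka s0).
by rewrite leNgt.
Qed.

(** Unboundedness gives [u] with [s < a u]; the intermediate value theorem on [[0, u]] does the
    rest. *)
Lemma Kinfty_surj a s : Kinfty a -> 0 <= s -> exists2 r, 0 <= r & a r = s.
Proof.
move=> Ka s0; have [u u0 su] : exists2 u, 0 <= u & s < a u by case: Ka.
have [r] : exists2 r, r \in `[0, u] & a r = s.
  apply: IVT => //.
    case: Ka => _ ca _ _; apply: continuous_subspaceW ca => r /=.
    by rewrite !in_itv/= andbT => /andP[].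
  by rewrite (Kinfty0 Ka) ge_min s0 le_max (ltW su) orbT.
by rewrite in_itv/= => /andP[r0 _] ars; exists r.
Qed.

Lemma Kinfty_inverse a : Kinfty a ->
  exists2 b, Kinfty b & forall r, 0 <= r -> b (a r) = r.
Proof.
move=> Ka.
(* At negative [s] nothing is required of the inverse, and 0 serves as a default. *)
have /choice[b b_spec] : forall s, exists r, 0 <= s -> 0 <= r /\ a r = s.
  move=> s; have [s0|s0] := leP 0 s; last by exists 0.
  by have [r r0 ars] := Kinfty_surj Ka s0; exists r.
have b_ge0 s : 0 <= s -> 0 <= b s by move=> /b_spec[].
have abK s : 0 <= s -> a (b s) = s by move=> /b_spec[].
(* [b_lt] and [b_gt] move [b] across a strict inequality; its continuity comes from this order
   information alone. *)
have b_lt r s : 0 <= r -> 0 <= s -> r < a s -> b r < s.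
  move=> r0 s0 ras; apply: (Kinfty_lt_reflect Ka s0) (b_ge0 _ r0).
  by rewrite abK.
have b_gt r s : 0 <= s -> 0 <= r -> a s < r -> s < b r.
  move=> s0 r0 asr; apply: (Kinfty_lt_reflect Ka (b_ge0 _ r0)) s0.
  by rewrite abK.
have baK r : 0 <= r -> b (a r) = r.
  move=> r0; have ar0 := Kinfty_ge0 Ka r0.
  apply/eqP; rewrite eq_le !leNgt; apply/andP; split; apply/negP => H.
  - by have := Kinfty_lt Ka r0 H; rewrite abK// ltxx.
  - by have := Kinfty_lt Ka (b_ge0 _ ar0) H; rewrite abK// ltxx.
exists b => //; apply: Kinfty_intro.
- by rewrite -{1}(Kinfty0 Ka) baK.
(* With [y] the value of [b] at the truncation of [r], nearby truncated points lie between
   [a (y - e)] and [a (y + e)], and [b] sends them into the interval from [y - e] to [y + e]. *)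
- move=> r; apply/cvgrPdist_lt => e e0.
  have max0 (s : R) : 0 <= Num.max 0 s by rewrite le_max lexx.
  set y := b (Num.max 0 r); have y0 : 0 <= y by exact: b_ge0.
  have ay : a y = Num.max 0 r by exact: abK.
  have ye0 : 0 <= y + e by rewrite addr_ge0// ltW.
  have cm : Num.max 0 s @[s --> r] --> Num.max 0 r by exact: maxr0_continuous.
  have near_lt : \forall s \near r, Num.max 0 s < a (y + e).
    apply: (cvgr_lt _ cm).
    by rewrite -ay; apply: Kinfty_lt => //; rewrite ltrDl.
  (* The guard is there because [a] is uncontrolled at negative arguments; if [y - e] is negative,
     the lower bound follows from [b] being nonnegative. *)
  have near_gt : \forall s \near r, 0 <= y - e -> a (y - e) < Num.max 0 s.
    have [ye|ye] := leP 0 (y - e); last by near=> s.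
    have : \forall s \near r, a (y - e) < Num.max 0 s.
      apply: (cvgr_gt _ cm).
      by rewrite -ay; apply: Kinfty_lt => //; rewrite ltrBlDr ltrDl.
    by apply: filterS.
  near=> s.
  rewrite ltr_distlC; apply/andP; split.
    have [ye|ye] := leP 0 (y - e); last exact: lt_le_trans ye (b_ge0 _ _).
    by apply: b_gt => //; move: ye; near: s.
  by apply: b_lt => //; near: s.
- move=> r s r0 rs; apply: b_lt => //; first by apply/b_ge0/(le_trans r0)/ltW.
  by rewrite abK// (le_trans r0)// ltW.
- move=> M; exists (a (`|M| + 1)); first by rewrite Kinfty_ge0// addr_ge0.
  by rewrite baK ?addr_ge0//; apply: le_lt_trans (ler_norm M) _; rewrite ltrDl.
Unshelve. all: by end_near.
Qed.

End ComparisonFunctions.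

(** * Class K-infinity majorants of continuous functions vanishing at the origin *)

Section KinftyMajorant.
Context {R : realType}.

Lemma trmx_continuous m n : continuous (@trmx R m n).
Proof.
move=> A s /= /(nbhs_ballP A^T) [e e0 es].
apply/nbhs_ballP; exists e => //= B [_ AB]; apply: es.
by split=> // i j; rewrite !mxE.
Qed.

(** Row vectors match [rV_compact]; the cube stands in for the Euclidean unit ball, which it
    contains. *)
Definition unit_cube n : set 'rV[R]_n :=
  [set u | forall i, `[-1, 1]%classic (u ord0 i)].
Arguments unit_cube : clear implicits.

Lemma compact_unit_cube n : compact (unit_cube n).
Proof. apply: (@rV_compact R n (fun=> `[-1, 1]%classic)) => _.
exact: segment_compact. Qed.

Lemma continuous_curry_left (T : topologicalType) (G : R -> T -> R) r :
  continuous (fun p : R * T => G p.1 p.2) -> continuous (G r).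
Proof.
move=> cG u; apply: (@continuous2_cvg _ _ _ _ (nbhs u) _ (fun=> r) id G).
- exact: (cG (r, u)).
- exact: cvg_cst.
- exact: cvg_id.
Qed.

(** Compactness makes the continuity in [r] uniform over [K]: for [s] near [r], [G r] and [G s]
    differ by at most [e] on all of [K], and hence so do their suprema. *)
Lemma sup_compact_continuous (T : topologicalType) (G : R -> T -> R) (K : set T) :
  compact K -> K !=set0 -> continuous (fun p : R * T => G p.1 p.2) ->
  continuous (fun r => sup [set G r u | u in K]).
Proof.
move=> cK K0 cG.
have cGr r : {within K, continuous (G r)}.
  exact/continuous_subspaceT/continuous_curry_left.
have G_sup r : has_sup [set G r u | u in K].
  split; first by case: K0 => u Ku; exists (G r u), u.
  have [c _ maxc] := compact_EVT_max K0 cK (cGr r).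
  by exists (G r c) => _ [u Ku <-]; apply: maxc; exact: mem_set.
move=> r; apply/cvgrPdist_le => e e0.
have near_G : \forall s \near r, K `<=` (fun u => `|G r u - G s u| <= e).
  have /compact_near_coveringP nK := cK.
  apply: (nK R (nbhs r) (fun s u => `|G r u - G s u| <= e)) => u Ku.
  (* The difference is jointly continuous and vanishes at [(u, r)], which is the local condition
     that the covering form of compactness globalizes. *)
  have cr : (fun p : T * R => G r p.1 - G p.2 p.1) @ (u, r) --> G r u - G r u.
    apply: cvgB.
      apply: (@continuous2_cvg _ _ _ _ (nbhs (u, r)) _ (fun=> r) fst G).
      - exact: (cG (r, u)).
      - exact: cvg_cst.
      - exact: cvg_fst.
    apply: (@continuous2_cvg _ _ _ _ (nbhs (u, r)) _ snd fst G).
    - exact: (cG (r, u)).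
    - exact: cvg_snd.
    - exact: cvg_fst.
  rewrite subrr in cr; move/cvgr0_norm_le: cr => /(_ e e0).
  exact.
near=> s.
have Gs : K `<=` (fun u => `|G r u - G s u| <= e) by near: s.
rewrite ler_distl; apply/andP; split.
- rewrite lerBlDr; apply: ge_sup; first exact: (G_sup s).1.
  move=> _ [u Ku <-]; apply: (@le_trans _ _ (G r u + e)).
    by have := Gs _ Ku; rewrite ler_distlC => /andP[].
  by rewrite lerD2r; apply: sup_upper_bound (G_sup r) _ _; exists u.
- apply: ge_sup; first exact: (G_sup r).1.
  move=> _ [u Ku <-]; apply: (@le_trans _ _ (G s u + e)).
    by have := Gs _ Ku; rewrite ler_distl => /andP[].
  by rewrite lerD2r; apply: sup_upper_bound (G_sup s) _ _; exists u.
Unshelve. all: by end_near.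
Qed.

(** The maximum of [g] over the cube of radius [r] is nondecreasing in [r] and vanishes at 0.
    Scaling to the fixed compact set [unit_cube] moves [r] into the integrand [G], which gives
    continuity. *)
Lemma Kinfty_majorant n (g : 'cV[R]_n -> R) : continuous g -> g 0 = 0 ->
  exists2 phi, Kinfty phi & forall x, g x <= phi (enorm x).
Proof.
move=> cg g0; pose G (r : R) (u : 'rV[R]_n) := g (r *: u^T).
have cG : continuous (fun p : R * 'rV[R]_n => G p.1 p.2).
  move=> p; apply: (continuous_comp (f := fun p : R * 'rV[R]_n => p.1 *: p.2^T)
    (g := g)); last exact: cg.
  apply: (@cvgZ _ _ _ (nbhs p) _ fst (fun p : R * 'rV[R]_n => p.2^T)).
    exact: cvg_fst.
  apply: (@continuous_comp _ _ _ (snd : R * 'rV[R]_n -> _) (@trmx R 1 n)).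
    exact: cvg_snd.
  exact: trmx_continuous.
have C0 : unit_cube n 0 by move=> i; rewrite /= mxE in_itv/= lerN10 ler01.
have cK := @compact_unit_cube n; have K0 : unit_cube n !=set0 by exists 0.
pose omega r := sup [set G r u | u in unit_cube n].
have c_omega : continuous omega by exact: sup_compact_continuous.
have le_omega r u : unit_cube n u -> G r u <= omega r.
  move=> Ku; have cGr : {within unit_cube n, continuous (G r)}.
    exact/continuous_subspaceT/continuous_curry_left.
  have [c _ maxc] := compact_EVT_max K0 cK cGr.
  apply: ub_le_sup; last by exists u.
  by exists (G r c) => _ [v Kv <-]; apply: maxc; exact: mem_set.
have omega_le r M : (forall u, unit_cube n u -> G r u <= M) -> omega r <= M.
  move=> GM; apply: ge_sup; first by exists (G r 0), 0.
  by move=> _ [u Ku <-]; exact: GM.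
have omega_ge0 r : 0 <= omega r.
  by rewrite -g0 -(scaler0 _ r) -trmx0; exact: le_omega.
have omega_homo r s : 0 <= r -> r < s -> omega r <= omega s.
  move=> r0 rs; have s0 : 0 < s by exact: le_lt_trans rs.
  apply: omega_le => u Ku.
  (* The cubes are nested: the factor [r / s] is at most 1, so rescaling by it keeps [u] in the unit
     cube. *)
  have -> : G r u = G s ((r / s) *: u).
    by rewrite /G linearZ/= scalerA mulrC divfK// gt_eqF.
  apply: le_omega => i; have := Ku i; rewrite /= mxE !in_itv/= -!ler_norml => ui.
  rewrite normrM mulr_ile1// ger0_norm ?divr_ge0 ?(ltW s0)//.
  by rewrite ler_pdivrMr// mul1r ltW.
(* The summand [r] makes the majorant strictly increasing and unbounded. *)
exists (fun r => r + omega r).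
- apply: Kinfty_intro.
  + rewrite add0r; apply/eqP; rewrite eq_le omega_ge0 andbT.
    by apply: omega_le => u _; rewrite /G scale0r g0.
  + move=> r; apply: cvgD; first exact: maxr0_continuous.
    apply: (continuous_comp (f := fun r : R => Num.max 0 r)) => //.
      exact: maxr0_continuous.
    exact: c_omega.
  + by move=> r s r0 rs; apply: ltr_leD => //; exact: omega_homo.
  + move=> M; exists (`|M| + 1); first by rewrite addr_ge0.
    have := ler_norm M; have := omega_ge0 (`|M| + 1); lra.
- move=> x; rewrite -[leLHS]add0r; apply: lerD; first exact: enorm_ge0.
  have [x0|x0] := eqVneq (enorm x) 0.
    suff -> : x = 0 by rewrite g0.
    apply/matrixP => i j; rewrite (ord1 j) mxE; apply/eqP.
    by rewrite -normr_le0 -x0; exact: coord_le_enorm.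
  have xp : 0 < enorm x by rewrite lt_neqAle eq_sym x0 enorm_ge0.
  (* Normalizing a nonzero [x] by its Euclidean norm puts every coordinate in [[-1, 1]]. *)
  have -> : g x = G (enorm x) ((enorm x)^-1 *: x^T).
    by rewrite /G linearZ/= trmxK scalerA divff// scale1r.
  apply: le_omega => i; rewrite /= !mxE in_itv/= -ler_norml.
  rewrite normrM ger0_norm ?invr_ge0 ?enorm_ge0// mulrC.
  by rewrite ler_pdivrMr// mul1r; exact: coord_le_enorm.
Qed.

End KinftyMajorant.

(** * Regularity and L2 norms of trajectories *)

Section Trajectories.
Context {R : realType}.
Local Notation mu := (@lebesgue_measure R).

Lemma abs_continuous_continuous n (x : R -> 'cV[R]_n) :
  (forall t, 0 <= t -> abs_continuous 0 t x) ->
  {within `[0, +oo[, continuous x}.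
Proof.
move=> acx; apply/subspace_continuousP => t /=; rewrite in_itv/= andbT => t0.
apply/cvgrPdist_lt => e e0.
(* The horizon [t + 1] leaves room to the right of [t]. Absolute continuity is then used for a
   single interval, and points within [Num.min d 1] of [t] stay below the horizon. *)
have [|d d0 dP] := acx (t + 1) _ e e0; first by rewrite addr_ge0.
have key u v : 0 <= u -> u <= v -> v <= t + 1 -> v - u < d ->
    enorm (x v - x u) < e.
  move=> u0 uv vt vud; have := dP 1%N (fun=> u) (fun=> v).
  rewrite !big_ord1; apply=> //.
  by apply/trivIsetP => i j _ _; rewrite (ord1 i) (ord1 j) eqxx.
have : \forall s \near t, `|t - s| < Num.min d 1.
  by apply: (nbhsx_ballx t); rewrite lt_min d0/=.
apply: filterS => s; rewrite lt_min => /andP[tsd ts1].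
rewrite /= in_itv/= andbT => s0; apply: le_lt_trans (norm_le_enorm _) _.
move: tsd ts1; rewrite !ltr_distl => /andP[? ?] /andP[? ?].
have [ts|st] := leP t s; last by apply: key => //; lra.
by rewrite -enormN opprB; apply: key => //; lra.
Qed.

Lemma solution_continuous n m (f : 'cV[R]_n -> 'cV[R]_m -> 'cV[R]_n) w x :
  is_solution f w x -> {within `[0, +oo[, continuous x}.
Proof. by case=> /abs_continuous_continuous. Qed.

Lemma continuous_along n (g : 'cV[R]_n -> R) (x : R -> 'cV[R]_n) (t : R) :
  continuous g -> {within `[0, +oo[, continuous x} ->
  {within `[0, t], continuous (g \o x)}.
Proof.
move=> cg cx; apply: within_continuous_comp; first by move=> z _; exact: cg.
apply: continuous_subspaceW cx => s /=.
by rewrite !in_itv/= andbT => /andP[].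
Qed.

(** Continuity on a compact interval; this is what licenses monotonicity and additivity of
    [Rintegral] below. *)
Lemma integrable_along n (g : 'cV[R]_n -> R) (x : R -> 'cV[R]_n) (t : R) :
  continuous g -> {within `[0, +oo[, continuous x} ->
  mu.-integrable `[0, t] (EFin \o (g \o x)).
Proof.
move=> cg cx; apply: continuous_compact_integrable.
  exact: segment_compact.
exact: continuous_along.
Qed.

Lemma within_continuous_col_mx (A : set R) n1 n2 (x1 : R -> 'cV[R]_n1)
    (x2 : R -> 'cV[R]_n2) :
  {within A, continuous x1} -> {within A, continuous x2} ->
  {within A, continuous (fun s => col_mx (x1 s) (x2 s))}.
Proof.
move=> /subspace_continuousP c1 /subspace_continuousP c2.
apply/subspace_continuousP => t At; apply/cvg_ballP => e e0.
have /cvg_ballP/(_ e e0) n1t := c1 t At.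
have /cvg_ballP/(_ e e0) n2t := c2 t At.
apply: filterS2 n1t n2t => s [_ b1] [_ b2]; split=> // i j.
by rewrite !mxE; case: splitP => k _; [exact: b1|exact: b2].
Qed.

(** Makes the state of one system an admissible input of the other, so that the gain bounds apply
    along feedback solutions. The bound comes from the extreme value theorem. *)
Lemma continuous_inputW n (x : R -> 'cV[R]_n) :
  {within `[0, +oo[, continuous x} -> inputW x.
Proof.
move=> cx; split=> [i|t t0].
  apply: subspace_continuous_measurable_fun => //.
  apply: (@within_continuous_comp _ _ _ _ x (fun z : 'cV[R]_n => z i 0)) cx => z _.
  exact: coord_continuous.
have [c _ maxc] := EVT_max t0 (continuous_along (t := t) (@enorm_continuous R n) cx).
exists (enorm (x c)); apply: aeW => s st.
by apply: (maxc s); rewrite in_itv.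
Qed.

Lemma sqr_enorm_continuous n (T : 'cV[R]_n -> 'cV[R]_n) : continuous T ->
  continuous (fun z => enorm (T z) ^+ 2).
Proof.
move=> cT z.
apply: (continuous_comp (f := fun z => enorm (T z)) (g := fun r : R => r ^+ 2)).
  by apply: continuous_comp; [exact: cT|exact: enorm_continuous].
exact: exprn_continuous.
Qed.

Lemma sqnormL2_ge0 n t (y : R -> 'cV[R]_n) : 0 <= sqnormL2 t y.
Proof. by apply: Rintegral_ge0 => s _; exact: sqr_ge0. Qed.

(** Squaring the pointwise bound turns the square root of [c] into [c]; then integrate. *)
Lemma sqnormL2_scale n (S T : 'cV[R]_n -> 'cV[R]_n) (c t : R)
    (x : R -> 'cV[R]_n) :
  continuous S -> continuous T -> 0 <= c ->
  (forall z, enorm (S z) <= Num.sqrt c * enorm (T z)) ->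
  {within `[0, +oo[, continuous x} ->
  sqnormL2 t (S \o x) <= c * sqnormL2 t (T \o x).
Proof.
move=> cS cT c0 ST cx.
have iT : mu.-integrable `[0, t] (EFin \o (fun s => enorm (T (x s)) ^+ 2)).
  exact: (integrable_along t (sqr_enorm_continuous cT) cx).
have ccT : continuous (fun z => c * enorm (T z) ^+ 2).
  move=> z; apply: (continuous_comp (f := fun z => enorm (T z) ^+ 2)).
    exact: sqr_enorm_continuous.
  exact: mulrl_continuous.
rewrite /sqnormL2 -RintegralZl//; apply: le_Rintegral => //.
- exact: (integrable_along t (sqr_enorm_continuous cS) cx).
- exact: (integrable_along t ccT cx).
- move=> s _ /=; rewrite -[in leRHS](sqr_sqrtr c0) -exprMn.
  by rewrite lerXn2r ?nnegrE ?mulr_ge0 ?sqrtr_ge0.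
Qed.

End Trajectories.

(** * The small-gain argument at a fixed time, and the feedback loop *)

Lemma small_gain_bound (R : realType) (g1 g2 : R -> R) (c1 c2 a1 a2 b1 b2 : R) :
  Kinfty g1 -> 0 < c2 -> Kinfty (fun s => s - g1 (c2 * g2 (c1 * s))) ->
  0 <= a1 -> 0 <= a2 -> 0 <= b1 ->
  a1 <= Num.max b1 (g1 (c2 * a2)) -> a2 <= Num.max b2 (g2 (c1 * a1)) ->
  a1 <= Num.max b1 (g1 (c2 * b2)).
Proof.
move=> Kg1 c20 Kg a10 a20 b10.
have g1_homo r s : 0 <= r -> r <= s -> g1 (c2 * r) <= g1 (c2 * s).
  by move=> r0 rs; apply: Kinfty_le => //; rewrite ?ler_pM2l// mulr_ge0// ltW.
(* An initial-state term in either maximum settles the claim, by monotonicity of [g1] in the second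
   case; only the two gain terms together close the loop. *)
rewrite !le_max => /orP[->//|a1g] /orP[a2b|a2g].
  by rewrite (le_trans a1g (g1_homo _ _ a20 a2b)) orbT.
have {}a1g := le_trans a1g (g1_homo _ _ a20 a2g).
have -> : a1 = 0.
  apply/eqP; rewrite eq_le a10 andbT leNgt; apply/negP => a1p.
  by have := Kinfty_lt Kg (lexx 0) a1p; rewrite (Kinfty0 Kg) subr_gt0 ltNge a1g.
by rewrite b10.
Qed.

Theorem theorem10 (R : realType) (n1 n2 : nat)
    (f1 : 'cV[R]_n1 -> 'cV[R]_n2 -> 'cV[R]_n1)
    (f2 : 'cV[R]_n2 -> 'cV[R]_n1 -> 'cV[R]_n2)
    (alpha1 beta1 gamma1 sigma1 alpha2 beta2 gamma2 sigma2 : R -> R)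
    (T1 S2 : 'cV[R]_n1 -> 'cV[R]_n1) (T2 S1 : 'cV[R]_n2 -> 'cV[R]_n2)
    (betah1 gammah1 betah2 gammah2 : R -> R) (c1 c2 : R)
    (f1_lip : loc_lipschitz f1) (f2_lip : loc_lipschitz f2)
    (f1_complete : forward_complete f1) (f2_complete : forward_complete f2)
    (f1_iISS : iISS f1 alpha1 beta1 gamma1 sigma1)
    (f2_iISS : iISS f2 alpha2 beta2 gamma2 sigma2)
    (feedback_complete : feedback_forward_complete f1 f2)
    (T1_coord : change_of_coordinates T1) (S1_coord : change_of_coordinates S1)
    (T2_coord : change_of_coordinates T2) (S2_coord : change_of_coordinates S2)
    (f1_gain : L2_gain f1 T1 S1 betah1 gammah1)
    (f2_gain : L2_gain f2 T2 S2 betah2 gammah2)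
    (c1_gt0 : 0 < c1) (c2_gt0 : 0 < c2)
    (S2_le_T1 : forall z, enorm (S2 z) <= Num.sqrt c1 * enorm (T1 z))
    (S1_le_T2 : forall z, enorm (S1 z) <= Num.sqrt c2 * enorm (T2 z))
    (small_gain1 : Kinfty (fun s => s - gammah1 (c2 * gammah2 (c1 * s))))
    (small_gain2 : Kinfty (fun s => s - gammah2 (c1 * gammah1 (c2 * s)))) :
  feedback_alpha_integrable f1 f2.
Proof.
case: T1_coord => T10 cT1 [T1' [T1K _ cT1']].
case: T2_coord => T20 cT2 [T2' [T2K _ cT2']].
case: S1_coord => _ cS1 _; case: S2_coord => _ cS2 _.
case: f1_gain => Kb1 Kg1 gain1; case: f2_gain => Kb2 Kg2 gain2.
have majorant n (T : 'cV[R]_n -> 'cV[R]_n) : T 0 = 0 -> continuous T ->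
    exists2 phi, Kinfty phi & forall z, enorm (T z) <= phi (enorm z).
  move=> T0 cT; apply: (@Kinfty_majorant R n (@enorm R n \o T)).
    by move=> z; apply: continuous_comp; [exact: cT|exact: enorm_continuous].
  by rewrite /= T0 enorm0.
have T10' : T1' 0 = 0 by rewrite -T10 T1K.
have T20' : T2' 0 = 0 by rewrite -T20 T2K.
(* The [phi] functions bound a state by its transform and lead to the integrand [alpha]; the [chi]
   functions bound the transform by the state and lead to [beta]. *)
have [phi1 Kphi1 le_phi1] := majorant _ T1' T10' cT1'.
have [phi2 Kphi2 le_phi2] := majorant _ T2' T20' cT2'.
have [chi1 Kchi1 le_chi1] := majorant _ T1 T10 cT1.
have [chi2 Kchi2 le_chi2] := majorant _ T2 T20 cT2.
have Kphi := Kinfty_add Kphi1 Kphi2.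
have [psi Kpsi phiK] := Kinfty_inverse Kphi.
have Kalpha := Kinfty_comp Kinfty_sqr Kpsi.
have alpha_le z1 z2 : psi (enorm (col_mx z1 z2)) ^+ 2 <=
    enorm (T1 z1) ^+ 2 + enorm (T2 z2) ^+ 2.
  (* Through [M] both majorants share one argument, so [psi] can invert their sum and gives at most
     [M]; the square of [M] is one of the two summands. *)
  set M := Num.max (enorm (T1 z1)) (enorm (T2 z2)).
  have M0 : 0 <= M by rewrite le_max enorm_ge0.
  have zM : enorm (col_mx z1 z2) <= phi1 M + phi2 M.
    apply: le_trans (enorm_col_mx_le _ _) _; apply: lerD.
    - rewrite -[in leLHS](T1K z1); apply: le_trans (le_phi1 _) _.
      by apply: Kinfty_le => //; rewrite ?enorm_ge0// le_max lexx.
    - rewrite -[in leLHS](T2K z2); apply: le_trans (le_phi2 _) _.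
      by apply: Kinfty_le => //; rewrite ?enorm_ge0// le_max lexx orbT.
  apply: (@le_trans _ _ (M ^+ 2)).
    apply: lerXn2r; rewrite ?nnegrE//.
      by apply: Kinfty_ge0 => //; exact: enorm_ge0.
    by rewrite -[leRHS]phiK//; apply: Kinfty_le => //; exact: enorm_ge0.
  by rewrite /M maxEle; case: ifP => _; rewrite ?lerDl ?lerDr sqr_ge0.
have c_alpha : continuous (fun z : 'cV[R]_(n1 + n2) => psi (enorm z) ^+ 2).
  (* [psi] is continuous only on the half-line; truncating its argument is harmless since norms are
     nonnegative. *)
  have -> : (fun z : 'cV[R]_(n1 + n2) => psi (enorm z) ^+ 2) =
      (fun r : R => psi (Num.max 0 r) ^+ 2) \o @enorm R _.
    by apply/funext => z /=; rewrite max_r// enorm_ge0.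
  move=> z; apply: continuous_comp; first exact: enorm_continuous.
  exact: (Kinfty_continuous Kalpha).
(* The maximum in the small-gain bound is replaced by a sum, with the transformed initial states
   majorized through [chi] and [chi']; this is a class K-infinity function of the full initial
   norm. *)
have Kb (bh bh' gh : R -> R) (c : R) (chi chi' : R -> R) :
    Kinfty bh -> Kinfty bh' -> Kinfty gh -> 0 < c -> Kinfty chi -> Kinfty chi' ->
    Kinfty (fun r => bh (chi r) + gh (c * bh' (chi' r))).
  move=> Kbh Kbh' Kgh c0 Kchi Kchi'.
  apply: (Kinfty_add (Kinfty_comp Kbh Kchi)).
  exact: (Kinfty_comp Kgh (Kinfty_comp (Kinfty_scale c0) (Kinfty_comp Kbh' Kchi'))).
have Kbeta := Kinfty_add (Kb _ _ _ _ _ _ Kb1 Kb2 Kg1 c2_gt0 Kchi1 Kchi2)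
                         (Kb _ _ _ _ _ _ Kb2 Kb1 Kg2 c1_gt0 Kchi2 Kchi1).
exists ((fun r : R => r ^+ 2) \o psi); eexists; split; [exact: Kalpha|exact: Kbeta|].
move=> x1 x2 [sol1 sol2] t t0.
have cx1 := solution_continuous sol1; have cx2 := solution_continuous sol2.
set a1 := sqnormL2 t (T1 \o x1); set a2 := sqnormL2 t (T2 \o x2).
set r := enorm (col_mx (x1 0) (x2 0)).
have [x1r x2r] := enorm_col_mx_ge (x1 0) (x2 0).
have [r10 r20] := (enorm_ge0 (x1 0), enorm_ge0 (x2 0)).
have a10 : 0 <= a1 by exact: sqnormL2_ge0.
have a20 : 0 <= a2 by exact: sqnormL2_ge0.
have b10 : 0 <= betah1 (enorm (T1 (x1 0))) by rewrite Kinfty_ge0 ?enorm_ge0.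
have b20 : 0 <= betah2 (enorm (T2 (x2 0))) by rewrite Kinfty_ge0 ?enorm_ge0.
(* The gain bound with input [x2], where the norm of [S1 \o x2] is replaced by [c2 * a2] inside
   [gammah1]. *)
have le1 : a1 <= Num.max (betah1 (enorm (T1 (x1 0)))) (gammah1 (c2 * a2)).
  apply: le_trans (gain1 _ _ (continuous_inputW cx2) sol1 _ t0) _.
  rewrite ge_max le_max lexx/= le_max; apply/orP; right.
  apply: Kinfty_le => //; first exact: sqnormL2_ge0.
  exact: sqnormL2_scale (ltW c2_gt0) S1_le_T2 cx2.
have le2 : a2 <= Num.max (betah2 (enorm (T2 (x2 0)))) (gammah2 (c1 * a1)).
  apply: le_trans (gain2 _ _ (continuous_inputW cx1) sol2 _ t0) _.
  rewrite ge_max le_max lexx/= le_max; apply/orP; right.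
  apply: Kinfty_le => //; first exact: sqnormL2_ge0.
  exact: sqnormL2_scale (ltW c1_gt0) S2_le_T1 cx1.
have bound (bh bh' gh chi chi' : R -> R) (c a u u' v v' : R) :
    Kinfty bh -> Kinfty bh' -> Kinfty gh -> 0 < c -> Kinfty chi -> Kinfty chi' ->
    0 <= u -> u <= chi v -> 0 <= v -> v <= r ->
    0 <= u' -> u' <= chi' v' -> 0 <= v' -> v' <= r ->
    a <= Num.max (bh u) (gh (c * bh' u')) ->
    a <= bh (chi r) + gh (c * bh' (chi' r)).
  move=> Kbh Kbh' Kgh c0 Kchi Kchi' u0 uv v0 vr u'0 uv' v'0 vr' /le_trans; apply.
  have u_le : bh u <= bh (chi r).
    by apply: Kinfty_le => //; apply: le_trans uv _; exact: Kinfty_le.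
  have u'_le : gh (c * bh' u') <= gh (c * bh' (chi' r)).
    apply: Kinfty_le => //; first by rewrite mulr_ge0 ?Kinfty_ge0// ltW.
    rewrite ler_pM2l//; apply: Kinfty_le => //; apply: le_trans uv' _.
    exact: Kinfty_le.
  have r0 : 0 <= r by exact: enorm_ge0.
  rewrite ge_max; apply/andP; split.
  - apply: le_trans u_le _; rewrite lerDl; apply: Kinfty_ge0 => //.
    apply: mulr_ge0; first exact: ltW.
    by apply: Kinfty_ge0 => //; exact: Kinfty_ge0.
  - apply: le_trans u'_le _; rewrite lerDr; apply: Kinfty_ge0 => //.
    exact: Kinfty_ge0.
(* [a1 + a2] separates the dynamics from the geometry: each term is at most its half of [beta], and
   the pointwise bound [alpha_le] integrates to the other inequality. *)
apply: (@le_trans _ _ (a1 + a2)); last first.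
  apply: lerD.
  - apply: (bound _ _ _ _ _ _ _ _ _ _ _ Kb1 Kb2 Kg1 c2_gt0 Kchi1 Kchi2
      (enorm_ge0 _) (le_chi1 _) r10 x1r (enorm_ge0 _) (le_chi2 _) r20 x2r).
    exact: (small_gain_bound Kg1 c2_gt0 small_gain1 a10 a20 b10 le1 le2).
  - apply: (bound _ _ _ _ _ _ _ _ _ _ _ Kb2 Kb1 Kg2 c1_gt0 Kchi2 Kchi1
      (enorm_ge0 _) (le_chi2 _) r20 x2r (enorm_ge0 _) (le_chi1 _) r10 x1r).
    exact: (small_gain_bound Kg2 c1_gt0 small_gain2 a20 a10 b20 le2 le1).
have i1 := integrable_along t (sqr_enorm_continuous cT1) cx1.
have i2 := integrable_along t (sqr_enorm_continuous cT2) cx2.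
rewrite /a1 /a2 /sqnormL2 -RintegralD//.
apply: le_Rintegral => //.
- exact: (integrable_along t c_alpha (within_continuous_col_mx cx1 cx2)).
- exact: (integrableD _ i1 i2).
- by move=> s _; exact: alpha_le.
Qed.
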